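(* For all $n\geq 2$ and $\sigma\in\{132,231\}$, the number $d_n(\sigma)$ of desarrangements of length $n$ avoiding $\sigma$ equals the Fine number $F_{n+1}$.
   Context: Permutations are in one-line notation. An index $i\in[n-1]$ is a descent of $\pi\in\mathfrak{S}_n$ if $\pi_i>\pi_{i+1}$; $i\in[n]$ is an ascent if it is not a descent (so $n$ is always an ascent). A desarrangement is a permutation whose first ascent is even. $d_n(\Pi)$ is the number of desarrangements in $\mathfrak{S}_n$ avoiding every pattern in $\Pi$ ($\pi$ avoids $\sigma$ if no subsequence of $\pi$ has the same relative order as $\sigma$). The Fine numbers $F_n$ are defined by $\sum_{n\ge0}F_nx^n=\frac{1-\sqrt{1-4x}}{3-\sqrt{1-4x}}$ (so $F_0=0,F_1=1,F_2=0,F_3=1,F_4=2,F_5=6,\dots$). *)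

(* Defs.v *)
From mathcomp Require Import all_boot all_order all_fingroup all_algebra.
From mathcomp Require Import ring.

Set Implicit Arguments.
Unset Strict Implicit.
Unset Printing Implicit Defensive.

Import GRing.Theory.

(* One-line notation: the word pi_1 ... pi_n with letters in {1, ..., n}. *)
Definition one_line n (p : 'S_n) : seq nat := [seq (p i).+1 | i <- enum 'I_n].

(* pi_i, for 1 <= i <= n. *)
Definition entry n (p : 'S_n) (i : nat) : nat := nth 0 (one_line p) i.-1.

Definition descent n (p : 'S_n) (i : nat) : bool :=
  (0 < i < n) && (entry p i.+1 < entry p i).

Definition ascent n (p : 'S_n) (i : nat) : bool :=
  (0 < i <= n) && ~~ descent p i.

(* For n > 0 the default value ord_max = n is itself an ascent, so this is the
   least ascent; for n = 0 it is 0, so the empty permutation is a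
   desarrangement. *)
Definition first_ascent n (p : 'S_n) : 'I_n.+1 :=
  [arg min_(i < ord_max | ascent p i) (i : nat)].

Definition desarrangement n (p : 'S_n) : bool := ~~ odd (first_ascent p).

Definition same_order (s t : seq nat) : bool :=
  (size s == size t) &&
  [forall i : 'I_(size s), forall j : 'I_(size s),
     (nth 0 s i < nth 0 s j) == (nth 0 t i < nth 0 t j)].

(* Patterns are permutations written as one-line words, e.g. [:: 1; 3; 2].
   The subsequences of a word of length n are its masks by n-tuples of bits. *)
Definition contains n (p : 'S_n) (s : seq nat) : bool :=
  [exists m : n.-tuple bool, same_order (mask m (one_line p)) s].

Definition avoids n (p : 'S_n) (s : seq nat) : bool := ~~ contains p s.

Definition num_desarr (n : nat) (Pi : seq (seq nat)) : nat :=
  #|[set p : 'S_n | desarrangement p && all (avoids p) Pi]|.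

Local Open Scope ring_scope.

(* Formal power series over the rationals, as coefficient sequences. *)
Definition fps := nat -> rat.

Definition fps_const (c : rat) : fps := fun n => if n is 0 then c else 0.
Definition fps_X : fps := fun n => if n is 1 then 1 else 0.
Definition fps_sub (a b : fps) : fps := fun n => a n - b n.
Definition fps_mul (a b : fps) : fps :=
  fun n => \sum_(i < n.+1) a i * b (n - i)%N.

(* Course-of-values recursion: [step] receives the list of the coefficients
   computed so far and returns the next one. *)
Fixpoint fps_prefix (step : seq rat -> rat) (n : nat) : seq rat :=
  if n is m.+1 then rcons (fps_prefix step m) (step (fps_prefix step m))
  else [::].
Definition fps_rec (step : seq rat -> rat) : fps :=
  fun n => step (fps_prefix step n).

(* The square root with constant term 1, meaningful when a 0 = 1. *)
Definition fps_sqrt (a : fps) : fps := fps_rec (fun s =>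
  if s is [::] then 1 else
  (a (size s) - \sum_(1 <= i < size s) s`_i * s`_(size s - i)) / 2).

(* The multiplicative inverse, meaningful when a 0 != 0. *)
Definition fps_inv (a : fps) : fps := fps_rec (fun s =>
  if s is [::] then (a 0%N)^-1 else
  - (a 0%N)^-1 * \sum_(i < size s) s`_i * a (size s - i)%N).

Definition fps_div (a b : fps) : fps := fps_mul a (fps_inv b).

Definition fine_gf : fps :=
  let r := fps_sqrt (fps_sub (fps_const 1) (fps_mul (fps_const 4) fps_X)) in
  fps_div (fps_sub (fps_const 1) r) (fps_sub (fps_const 3) r).

Definition Fine (n : nat) : rat := fine_gf n.

Lemma size_fps_prefix step n : size (fps_prefix step n) = n.
Proof. by elim: n => //= n IHn; rewrite size_rcons IHn. Qed.

Lemma nth_fps_prefix step n i :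
  (i < n)%N -> (fps_prefix step n)`_i = fps_rec step i.
Proof.
elim: n => //= n IHn; rewrite ltnS leq_eqVlt nth_rcons size_fps_prefix.
by case: ltngtP => //= [lt_in _|->//]; exact: IHn.
Qed.

Lemma fps_sqrt0 a : fps_sqrt a 0%N = 1. Proof. by []. Qed.

Lemma fps_sqrtP a :
  a 0%N = 1 -> forall n, fps_mul (fps_sqrt a) (fps_sqrt a) n = a n.
Proof.
move=> a0 [|n]; first by rewrite /fps_mul big_ord1 subnn fps_sqrt0 mulr1 a0.
set S := fps_sqrt a.
have SE : S n.+1 = (a n.+1 - \sum_(1 <= i < n.+1) S i * S (n.+1 - i)%N) / 2.
  rewrite {1}/S /fps_sqrt /fps_rec; set st := (X in fps_prefix X _).
  have := size_fps_prefix st n.+1.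
  case E: (fps_prefix st n.+1) => [|x s] //; rewrite -E => sz.
  rewrite sz; congr ((_ - _) / _); apply: eq_big_nat => i /andP[i0 iln].
  rewrite !nth_fps_prefix //.
  by rewrite ltn_subrL i0.
rewrite /fps_mul big_ord_recl big_ord_recr /= subn0 /bump /= add1n subnn.
rewrite /S fps_sqrt0 -/S mul1r mulr1 SE big_add1 /= big_mkord.
under [X in _ + (X + _)]eq_bigr => i _ do rewrite add1n.
by field.
Qed.

Lemma fps_invP a :
  a 0%N != 0 -> forall n, fps_mul (fps_inv a) a n = fps_const 1 n.
Proof.
move=> a0 [|n]; first by rewrite /fps_mul big_ord1 subnn mulVf.
set I := fps_inv a.
have IE : I n.+1 = - (a 0%N)^-1 * \sum_(i < n.+1) I i * a (n.+1 - i)%N.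
  rewrite {1}/I /fps_inv /fps_rec; set st := (X in fps_prefix X _).
  have := size_fps_prefix st n.+1.
  case E: (fps_prefix st n.+1) => [|x s] //; rewrite -E => sz.
  rewrite sz; congr (_ * _); apply: eq_bigr => i _.
  by rewrite nth_fps_prefix.
rewrite /fps_mul big_ord_recr /= subnn IE; by field.
Qed.

(* Main.v *)
(** Write a nonempty 132- or 231-avoider as [L m R] with [m] its maximum.  Then
    [L] and [R] avoid the pattern, and all letters of [L] exceed (132), resp.
    are below (231), all letters of [R].  The first ascent of the word is that of
    [L] if [L] is nonempty, and one more than that of [R] otherwise.  Hence in
    both cases, with [C] the Catalan series and [D] the series of the avoiders
    with even first ascent, [D = 1 + x (C - D) + x (D - 1) C], that is
    [D (1 + x - x C) = 1].  As [x C = (1 - r) / 2] with [r = sqrt (1 - 4x)], the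
    Fine series [F = (1 - r) / (3 - r)] satisfies [F (1 + r + 2x) = 2x], so
    [F = x D]. *)
Require Import Defs.
From mathcomp Require Import all_boot all_order all_fingroup all_algebra.
From mathcomp Require Import ring lra zify.

Set Implicit Arguments.
Unset Strict Implicit.
Unset Printing Implicit Defensive.

Import GRing.Theory.

(** * Recurrences for the Catalan and Fine numbers from their power series *)

Section FineSeries.

Local Open Scope ring_scope.

(** Turns agreement of coefficients below [N] into an equation with an explicit error term, so that
    power series identities become polynomial ones within reach of [ring]. *)
Lemma poly_eq_modXn (N : nat) (p q : {poly rat}) :
  (forall i, (i < N)%N -> p`_i = q`_i) -> exists u, p = q + u * 'X^N.
Proof.
move=> e; exists (drop_poly N (p - q)).
rewrite -[p in LHS](subrK q) addrC -{1}(poly_take_drop N (p - q)).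
suff -> : take_poly N (p - q) = 0 by rewrite add0r.
apply/polyP => i; rewrite coef_take_poly coef0.
by case: ifP => // lt; rewrite coefB e // subrr.
Qed.

Definition trunc (N : nat) (a : fps) : {poly rat} := \poly_(i < N) a i.

Lemma coef_trunc N a i : (i < N)%N -> (trunc N a)`_i = a i.
Proof. by move=> lt; rewrite coef_poly lt. Qed.

Lemma coef_truncM N a b i :
  (i < N)%N -> (trunc N a * trunc N b)`_i = fps_mul a b i.
Proof.
move=> lt; rewrite coefM; apply: eq_bigr => j _.
rewrite !coef_trunc //; first exact: leq_ltn_trans (leq_subr _ _) lt.
by rewrite (leq_ltn_trans _ lt) // -ltnS.
Qed.

Definition sqrt_1m4X : fps :=
  fps_sqrt (fps_sub (fps_const 1) (fps_mul (fps_const 4) fps_X)).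

Lemma coef_1m4X i :
  fps_sub (fps_const 1) (fps_mul (fps_const 4) fps_X) i =
  (1 - 4 *: 'X : {poly rat})`_i.
Proof.
rewrite coefB coefZ coefX coef1 /fps_sub; congr (_ - _); first by case: i.
rewrite /fps_mul big_ord_recl big1 ?addr0; last by move=> j _; rewrite mul0r.
by rewrite subn0; case: i => [|[|i]].
Qed.

Lemma sqrt_1m4XP i : fps_mul sqrt_1m4X sqrt_1m4X i = (1 - 4 *: 'X : {poly rat})`_i.
Proof. by rewrite fps_sqrtP ?coef_1m4X // !coefE mulr0 subr0. Qed.

(* [(1 - r) (1 + r + 2x) = 2x (3 - r)] because [r^2 = 1 - 4x]. *)
Lemma fine_gf_equation i :
  fps_mul fine_gf (fun j => (1 + 2 *: 'X : {poly rat})`_j + sqrt_1m4X j) i =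
  (2 *: 'X : {poly rat})`_i.
Proof.
(* Coefficient [i] is unaffected by multiples of ['X^N] once [N] exceeds [i]. *)
pose N := i.+1; set r := sqrt_1m4X.
pose a := fps_sub (fps_const 1) r; pose b := fps_sub (fps_const 3) r.
rewrite -(@coef_truncM N) //.
have [uR eR] : exists u, trunc N r * trunc N r = 1 - 4 *: 'X + u * 'X^N.
  by apply: poly_eq_modXn => j lt; rewrite coef_truncM // sqrt_1m4XP.
have [uI eI] : exists u, trunc N (fps_inv b) * trunc N b = 1 + u * 'X^N.
  apply: poly_eq_modXn => j lt; rewrite coef_truncM // fps_invP //.
  by rewrite coef1; case: (j).
have [uF eF] : exists u,
    trunc N fine_gf = trunc N a * trunc N (fps_inv b) + u * 'X^N.
  by apply: poly_eq_modXn => j lt; rewrite coef_trunc // coef_truncM.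
have [ua ea] : exists u, trunc N a = 1 - trunc N r + u * 'X^N.
  apply: poly_eq_modXn => j lt; rewrite coefB !coef_trunc // coef1.
  by rewrite /a /fps_sub; case: (j).
have [ub eb] : exists u, trunc N b = 3%:P - trunc N r + u * 'X^N.
  apply: poly_eq_modXn => j lt; rewrite coefB !coef_trunc // coefC.
  by rewrite /b /fps_sub; case: (j).
set c := (X in trunc N fine_gf * trunc N X).
have [uc ec] : exists u, trunc N c = 1 + 2 *: 'X + trunc N r + u * 'X^N.
  by apply: poly_eq_modXn => j lt; rewrite [in RHS]coefD !coef_trunc.
suff [u ->] : exists u, trunc N fine_gf * trunc N c = 2 *: 'X + u * 'X^N.
  by rewrite coefD coefMXn ltnSn addr0.
move: eI; rewrite eF ec ea eb -!mul_polyC in eR *.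
set R := trunc N r in eR *; set I := trunc N (fps_inv b); set Y := 'X^N in eR *.
move=> eI.
have -> : (2 : rat)%:P = 2 by rewrite rmorph_nat.
move: eR eI.
have -> : (4 : rat)%:P = 4 by rewrite rmorph_nat.
have -> : (3 : rat)%:P = 3 by rewrite rmorph_nat.
move=> eR eI.
(* The witness gathers all error terms multiplying [Y] when the product is expanded by means of [(1
   - R) (1 + 2X + R) = 2X (3 - R) - (R^2 - (1 - 4X))]; what remains are the multiples of [eR] and
   [eI] displayed below. *)
exists (uF * (1 + 2 * 'X + R + uc * Y) + ua * I * (1 + 2 * 'X + R + uc * Y)
        + (1 - R) * I * uc + (2 * 'X) * (uI - I * ub) - I * uR).
set c' := 1 + 2 * 'X + R + uc * Y.
transitivity (2 * 'X + (uF * c' + ua * I * c' + (1 - R) * I * uc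
    + 2 * 'X * (uI - I * ub) - I * uR) * Y
    - I * (R * R - (1 - 4 * 'X + uR * Y))
    + 2 * 'X * (I * (3 - R + ub * Y) - (1 + uI * Y))).
  by rewrite /c'; ring.
by rewrite eR eI !subrr !mulr0 subr0 addr0.
Qed.

(** Coefficients of [(1 - r) / (2x)], where [r] is the square root of [1 - 4x]. *)
Definition catalan (n : nat) : rat := - sqrt_1m4X n.+1 / 2.

Lemma sqrt_1m4X0 : sqrt_1m4X 0 = 1.
Proof. by []. Qed.

Lemma sqrt_1m4XS n : sqrt_1m4X n.+1 = - (2 * catalan n).
Proof. by rewrite /catalan; field. Qed.

Lemma catalan0 : catalan 0 = 1.
Proof.
have := sqrt_1m4XP 1; rewrite /fps_mul !big_ord_recl big_ord0 /= sqrt_1m4X0.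
rewrite subn0 sqrt_1m4XS coefB coefZ coef1 coefX /= => e.
have -> : catalan 0 = - (1 * - (2 * catalan 0) + (- (2 * catalan 0) * 1 + 0)) / 4.
  by field.
by rewrite e; field.
Qed.

(** Coefficient [n + 2] of [r^2 = 1 - 4x] vanishes: its two extreme terms give [-4 catalan n.+1],
    and the inner ones four times the convolution. *)
Lemma catalanS n :
  catalan n.+1 = \sum_(i < n.+1) catalan i * catalan (n - i).
Proof.
have := sqrt_1m4XP n.+2; rewrite /fps_mul big_ord_recl big_ord_recr /=.
rewrite /bump /= add1n subnn subn0 sqrt_1m4X0 sqrt_1m4XS.
under eq_bigr => i _ do
  rewrite /= add1n subSS subSn -1?ltnS // !sqrt_1m4XS mulrNN mulrACA.
rewrite -mulr_sumr coefB coefZ coef1 coefX /= => e.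
set S := \sum_(i < n.+1) _ in e *.
rewrite mulr0n in e; lra.
Qed.

Lemma Fine0 : Fine 0 = 0.
Proof.
have := fine_gf_equation 0; rewrite /fps_mul big_ord1 subnn sqrt_1m4X0.
rewrite !coefE /= !mulr0 addr0 => /eqP.
by rewrite mulf_eq0 => /orP[/eqP //|/eqP].
Qed.

Lemma Fine1 : Fine 1 = 1.
Proof.
have := fine_gf_equation 1; rewrite /fps_mul !big_ord_recl big_ord0 /=.
rewrite -/(Fine 0) Fine0 mul0r add0r addr0 subnn sqrt_1m4X0 !coefE /= -/(Fine 1).
rewrite mulr0 addr0 mulr1 => e.
by have -> : Fine 1 = Fine 1 * (1 + 1) / 2; [field | rewrite e; field].
Qed.

(** Since [r = 1 - 2xC], [fine_gf_equation] reads [F (1 + x - xC) = x] after halving; this is its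
    coefficient of degree [n + 2]. *)
Lemma Fine_rec n :
  Fine n.+2 = \sum_(i < n.+1) Fine i.+1 * catalan (n - i) - Fine n.+1.
Proof.
have := fine_gf_equation n.+2; rewrite /fps_mul big_ord_recl big_ord_recr /=.
rewrite /bump /= !add1n subnn -/(Fine 0) Fine0 mul0r add0r sqrt_1m4X0.
rewrite -/(Fine n.+2).
(* The second factor is taken at [n + 1 - i >= 1], so its constant term never enters, and [2 *: 'X]
   contributes only at [i = n]. *)
have -> : \sum_(i < n.+1) fine_gf (1 + i)%N *
      ((1 + 2 *: 'X : {poly rat})`_(n.+2 - (1 + i)) + sqrt_1m4X (n.+2 - (1 + i))%N)
  = 2 * Fine n.+1 - 2 * \sum_(i < n.+1) Fine i.+1 * catalan (n - i).
  under eq_bigr => i _.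
    rewrite /= add1n subSS subSn -1?ltnS // sqrt_1m4XS -/(Fine i.+1) mulrBr mulrCA.
    rewrite coefD coefZ coef1 coefX /= add0r eqSS; over.
  rewrite sumrB -mulr_sumr; congr (_ - _).
  rewrite big_ord_recr /= subnn big1 ?add0r ?mulr1 1?mulrC // => i _.
  by rewrite subn_eq0 leqNgt ltn_ord /= mulr0n !mulr0.
rewrite !coefE /= !mulr0n => e; lra.
Qed.
End FineSeries.

(** * Pattern avoidance for words, split at the maximum *)

(* The pattern is 132 if [b] and 231 otherwise. *)
Definition pat (b : bool) (x y z : nat) : bool :=
  if b then x < z < y else z < x < y.

Definition word_avoids (b : bool) (w : seq nat) : Prop :=
  forall x y z, subseq [:: x; y; z] w -> ~~ pat b x y z.

Lemma subseq_catP (T : eqType) (s u v : seq T) :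
  subseq s (u ++ v) ->
  exists s1 s2, [/\ s = s1 ++ s2, subseq s1 u & subseq s2 v].
Proof.
case/subseqP=> m sz ->; exists (mask (take (size u) m) u), (mask (drop (size u) m) v).
rewrite !mask_subseq -mask_cat ?cat_take_drop //.
by rewrite size_takel // sz size_cat leq_addr.
Qed.

(** The middle letter is the largest in both patterns, so [m] can only play that role. Any
    occurrence not inside [L] or [R] thus has its first letter in [L] and its last in [R], in the
    excluded order; conversely such a pair forms the pattern around [m]. *)
Lemma word_avoids_cat_max b L m R :
  (forall x, x \in L ++ R -> x < m) ->
  word_avoids b (L ++ m :: R) <->
  [/\ word_avoids b L, word_avoids b R &
      forall x z, x \in L -> z \in R -> ~~ (if b then x < z else z < x)].
Proof.
move=> lm; split=> [av|[avL avR cr] x y z].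
  split=> [x y z s|x y z s|x z xL zR].
  - by apply: av; apply: subseq_trans s _; apply: prefix_subseq.
  - apply: av; apply: subseq_trans s _.
    by apply: subseq_trans (suffix_subseq L _); apply: subseq_cons.
  have xm : x < m by apply: lm; rewrite mem_cat xL.
  have zm : z < m by apply: lm; rewrite mem_cat zR orbT.
  have /av : subseq [:: x; m; z] (L ++ m :: R).
    rewrite -cat1s; apply: cat_subseq; rewrite ?sub1seq //=.
    by rewrite eqxx sub1seq.
  by rewrite /pat xm zm !andbT.
case/subseq_catP=> s1 [s2 [e sL sR]].
have ltR t : t \in R -> t < m by move=> tR; apply: lm; rewrite mem_cat tR orbT.
have ltL t : t \in L -> t < m by move=> tL; apply: lm; rewrite mem_cat tL.
(* Cases by the number of letters of the occurrence that lie in [L]. *)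
case: s1 e sL => [|x1 [|x2 [|x3 [|]]]] //= e sL.
- rewrite -e /= in sR; case: eqP sR => [->|_] sR; last exact: avR.
  have := mem_subseq sR; move/(_ y); rewrite mem_head => /(_ isT) /ltR ym.
  rewrite /pat; apply/negP; case: (b); lia.
- case: e => ? e; subst x1; rewrite -e in sR.
  rewrite sub1seq in sL; move: sR => /=; case: eqP => [->|_] sR.
    by rewrite sub1seq in sR; move: (cr _ _ sL sR); rewrite /pat; case: (b); lia.
  have := mem_subseq sR => h.
  have yR : y \in R by apply: h; rewrite !inE eqxx.
  have zR : z \in R by apply: h; rewrite !inE eqxx orbT.
  move: (cr _ _ sL yR) (cr _ _ sL zR); rewrite /pat; case: (b); lia.
- case: e => ? ? e; subst x1 x2; rewrite -e sub1seq in_cons in sR.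
  have := mem_subseq sL => h.
  have xL : x \in L by apply: h; rewrite !inE eqxx.
  have yL : y \in L by apply: h; rewrite !inE eqxx orbT.
  case/orP: sR => [/eqP->|zR].
    by move: (ltL _ xL) (ltL _ yL); rewrite /pat; case: (b); lia.
  move: (cr _ _ xL zR) (cr _ _ yL zR); rewrite /pat; case: (b); lia.
- by case: e => -> -> -> _; exact: avL.
Qed.

(** Sorting both parts separately already sorts the whole, which is therefore the interval itself,
    cut at [size A]. *)
Lemma perm_cat_iota a n (A B : seq nat) :
  perm_eq (A ++ B) (iota a n) ->
  (forall x y, x \in A -> y \in B -> x < y) ->
  perm_eq A (iota a (size A)) /\ perm_eq B (iota (a + size A) (size B)).
Proof.
move=> pe lt.
have sz : n = size A + size B by rewrite -size_cat (perm_size pe) size_iota.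
have srt : sorted leq (sort leq A ++ sort leq B).
  apply/(sortedP 0) => i.
  rewrite size_cat !size_sort => ilt; rewrite !nth_cat size_sort.
  have sA := sort_sorted leq_total A; have sB := sort_sorted leq_total B.
  case: (ltnP i (size A)) => iA; case: (ltnP i.+1 (size A)) => iA' //.
  - by move/(sortedP 0): sA; apply; rewrite size_sort.
  - apply/ltnW/lt.
      by rewrite -(mem_sort leq) mem_nth // size_sort.
    by rewrite -(mem_sort leq) mem_nth // size_sort ltn_subLR.
  - lia.
  - rewrite subSn //; move/(sortedP 0): sB; apply.
    by rewrite size_sort -subSn // ltn_subLR // leqW.
have e : sort leq A ++ sort leq B = iota a n.
  apply: (sorted_eq leq_trans anti_leq) => //; first exact: iota_sorted.
  by rewrite (perm_trans _ pe) // perm_cat // perm_sort.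
move/eqP: e; rewrite sz iotaD eqseq_cat ?size_sort ?size_iota //.
by case/andP=> /eqP<- /eqP<-; rewrite !(perm_sym _ (sort _ _)) !perm_sort.
Qed.

Lemma perm_cat_max_iota a n (L R : seq nat) :
  perm_eq (L ++ a + n :: R) (iota a n.+1) = perm_eq (L ++ R) (iota a n).
Proof.
rewrite -cat1s perm_catCA cat1s -[n.+1]addn1 iotaD cats1.
by rewrite perm_sym perm_rcons perm_sym perm_cons.
Qed.

(** * Recursive enumeration of the avoiders *)

(* In a 132-avoider ([b]) the letters left of the maximum exceed those right of
   it; in a 231-avoider it is the other way round. *)
Definition lshift_words (b : bool) n k := if b then n - k else 0.
Definition rshift_words (b : bool) (k : nat) := if b then 0 else k.

(* [f] is recursion fuel: only [n <= f] is meaningful. *)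
Fixpoint avoiders (b : bool) (f n a : nat) : seq (seq nat) :=
  match f, n with
  | f'.+1, n'.+1 =>
    [seq p.1 ++ (a + n') :: p.2 | k <- iota 0 n'.+1,
       p <- [seq (L, R) | L <- avoiders b f' k (a + lshift_words b n' k),
                          R <- avoiders b f' (n' - k) (a + rshift_words b k)]]
  | _, _ => [:: [::]]
  end.

Lemma avoidersS b f n a :
  avoiders b f.+1 n.+1 a =
  [seq p.1 ++ (a + n) :: p.2 | k <- iota 0 n.+1,
     p <- [seq (L, R) | L <- avoiders b f k (a + lshift_words b n k),
                        R <- avoiders b f (n - k) (a + rshift_words b k)]].
Proof. by []. Qed.

(** Cutting at the maximum [a + n], the cross condition of [word_avoids_cat_max] forces the letters
    of each part to fill an interval, so recursive calls on intervals miss nothing. *)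
Lemma avoidersP b f n a w : n <= f ->
  w \in avoiders b f n a <-> perm_eq w (iota a n) /\ word_avoids b w.
Proof.
elim: f n a w => [|f IH] [|n] a w //; rewrite ?ltnS => nf.
1,2: rewrite inE; split=> [/eqP->//|[/perm_nilP->//]].
split.
  case/allpairsPdep=> k [[L R]] [].
  rewrite mem_iota add0n /= ltnS => kn /allpairsP[[L' R']] /= [hL hR [-> ->]] ->.
  have [pL aL] := (IH k _ L' (leq_trans kn nf)).1 hL.
  have [pR aR] := (IH (n - k) _ R' (leq_trans (leq_subr _ _) nf)).1 hR.
  have mL x : x \in L' -> a + lshift_words b n k <= x < a + lshift_words b n k + k.
    by rewrite (perm_mem pL) mem_iota.
  have mR x : x \in R' -> a + rshift_words b k <= x < a + rshift_words b k + (n - k).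
    by rewrite (perm_mem pR) mem_iota.
  split.
    rewrite -[_ :: iota _ _]/(iota a n.+1) perm_cat_max_iota.
    rewrite (perm_trans (perm_cat pL pR)) //.
    rewrite /lshift_words /rshift_words; case: (b); rewrite !addn0.
      by rewrite perm_catC -iotaD subnK.
    by rewrite -iotaD subnKC.
  apply/word_avoids_cat_max.
    move=> x; rewrite mem_cat => /orP[/mL|/mR];
    rewrite /lshift_words /rshift_words; case: (b); lia.
  split=> // x z /mL + /mR; rewrite /lshift_words /rshift_words; case: (b); lia.
case=> pw av.
have mw : a + n \in w by rewrite (perm_mem pw) mem_iota; lia.
have uw : uniq w by rewrite (perm_uniq pw) iota_uniq.
move: mw pw av uw; case/splitPr=> L R pw av uw.
have pw' : perm_eq (L ++ R) (iota a n) by rewrite -perm_cat_max_iota.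
have lm x : x \in L ++ R -> x < a + n.
  by rewrite (perm_mem pw') mem_iota => /andP[].
have sz : size L + size R = n by rewrite -size_cat (perm_size pw') size_iota.
case/(word_avoids_cat_max _ lm): av => avL avR cr.
(* Distinctness of the letters makes the cross condition strict, as [perm_cat_iota] demands. *)
have neq x z : x \in L -> z \in R -> x != z.
  move=> xL zR; apply/eqP=> xz; move: uw.
  rewrite cat_uniq => /and3P[_ /hasPn/(_ z)]; rewrite in_cons zR orbT -xz xL.
  by move=> /(_ isT).
apply/allpairsPdep; exists (size L), (L, R); split=> //.
  by rewrite mem_iota; lia.
have -> : n - size L = size R by lia.
have [pL pR] : perm_eq L (iota (a + lshift_words b n (size L)) (size L)) /\
               perm_eq R (iota (a + rshift_words b (size L)) (size R)).
  rewrite /lshift_words /rshift_words.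
  have -> : n - size L = size R by lia.
  case: (b) cr; rewrite ?addn0 => cr.
    (* For 132 the smaller letters are in [R], so the parts are exchanged first. *)
    rewrite and_comm; apply: (@perm_cat_iota _ n); first by rewrite perm_catC.
    by move=> x y xR yL; move: (cr _ _ yL xR) (neq _ _ yL xR); lia.
  apply: (perm_cat_iota pw') => x y xL yR.
  by move: (cr _ _ xL yR) (neq _ _ xL yR); lia.
have Lf : size L <= f by rewrite (leq_trans _ nf) // -sz leq_addr.
have Rf : size R <= f by rewrite (leq_trans _ nf) // -sz leq_addl.
by apply/allpairsP; exists (L, R); split=> //; [apply/(IH _ _ _ Lf)|apply/(IH _ _ _ Rf)].
Qed.

(** The position of the maximum determines [k], and then the two parts are determined. *)
Lemma avoiders_uniq b f n a : n <= f -> uniq (avoiders b f n a).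
Proof.
elim: f n a => [|f IH] [|n] a //; rewrite ltnS => nf.
rewrite avoidersS; apply: allpairs_uniq_dep; first exact: iota_uniq.
  move=> k; rewrite mem_iota => kn.
  by apply: allpairs_uniq; try (by apply: IH; lia); move=> [? ?] [? ?] _ _.
move=> u v /allpairsPdep[k [_ [hk /allpairsP[[L R] [hL _ ->]] ->]]].
move=> /allpairsPdep[k' [_ [hk' /allpairsP[[L' R'] [hL' _ ->]] ->]]] /= e.
rewrite mem_iota in hk; rewrite mem_iota in hk'.
have mL j M : j < n.+1 -> M \in avoiders b f j (a + lshift_words b n j) ->
    size M = j /\ a + n \notin M.
  move=> jn /avoidersP[|pM _]; first lia.
  rewrite (perm_size pM) (perm_mem pM) size_iota mem_iota; split=> //.
  by rewrite /lshift_words; case: (b); lia.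
have [sL nL] := mL k L hk hL; have [sL' nL'] := mL k' L' hk' hL'.
have kk : k = k'.
  have := congr1 (index (a + n)) e.
  by rewrite !index_cat (negPf nL) (negPf nL') /= eqxx !addn0 sL sL'.
move/eqP: e; rewrite eqseq_cat ?sL ?sL' // eqseq_cons eqxx /=.
by case/andP=> /eqP-> /eqP->; rewrite kk.
Qed.

(** * The first ascent of a word *)

Fixpoint first_asc (w : seq nat) : nat :=
  if w is x :: s then
    if s is y :: _ then if y < x then (first_asc s).+1 else 1 else 1
  else 0.

Lemma first_asc_cons_max m R :
  (forall x, x \in R -> x < m) -> first_asc (m :: R) = (first_asc R).+1.
Proof. by case: R => [|y R] //= h; rewrite h // mem_head. Qed.

(** The last position of [L] counts as an ascent of [L], and it remains one before the larger letter
    [m]. *)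
Lemma first_asc_cat_max L m R : L != [::] ->
  (forall x, x \in L -> x < m) -> first_asc (L ++ m :: R) = first_asc L.
Proof.
elim: L => // x [|y L] IH _ h /=.
  by rewrite ltnNge ltnW // h // mem_head.
case: ifP => // _; congr _.+1; apply: IH => // z zL.
by apply: h; rewrite in_cons zL orbT.
Qed.

Lemma first_asc_le w : first_asc w <= size w.
Proof.
by elim: w => // x [|y w] //= IH; case: ifP.
Qed.

Lemma first_asc_gt0 w : w != [::] -> 0 < first_asc w.
Proof. by case: w => // x [|y w] _ //=; case: ifP. Qed.

Lemma first_asc_desc w i : 0 < i < first_asc w -> nth 0 w i < nth 0 w i.-1.
Proof.
elim: w i => [|x [|y w] IH] i //=; first lia.
  by case: i => [|[]].
case: ifP => [yx|_]; last by case: i => [|[]].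
by case: i => [|[|i]] //= h; apply: (IH i.+1).
Qed.

Lemma first_asc_asc w :
  first_asc w < size w -> nth 0 w (first_asc w).-1 <= nth 0 w (first_asc w).
Proof.
elim: w => // x [|y w] IH //.
rewrite [first_asc _]/=; case: ifP => [yx|/negbT]; last by rewrite -leqNgt.
have : 0 < first_asc (y :: w) by apply: first_asc_gt0.
rewrite -/(first_asc (y :: w)); move: IH; by case: (first_asc (y :: w)).
Qed.

(** Position [first_asc] is an ascent and all earlier positions are descents, so it is the minimum
    selected by [first_ascent]. *)
Lemma first_ascentE n (p : 'S_n) : first_ascent p = first_asc (one_line p) :> nat.
Proof.
have szw : size (one_line p) = n by rewrite size_map size_enum_ord.
set w := one_line p in szw *.
have fl : first_asc w < n.+1 by rewrite ltnS -szw first_asc_le.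
case: (posnP n) => [n0|n0]; first by move: (leq_ord (first_ascent p)); lia.
have fA : ascent p (Ordinal fl).
  have f0 : 0 < first_asc w by rewrite first_asc_gt0 // -size_eq0 szw -lt0n.
  rewrite /ascent /descent /entry /= f0 -ltnS fl /=.
  by apply/negP=> /andP[lt]; rewrite ltnNge first_asc_asc // szw.
rewrite /first_ascent; case: arg_minnP.
  (* [arg_minnP] asks that its default [ord_max] be an ascent; position [n] is never a descent. *)
  by rewrite /ascent /descent /= n0 ltnn andbF leqnn.
move=> i ai /(_ _ fA) /= le; apply/eqP; rewrite eqn_leq le leqNgt; apply/negP=> lt.
move: ai; rewrite /ascent /descent => /andP[/andP[i0 _]] /negP; apply.
have h : 0 < i < first_asc w by rewrite i0.
rewrite i0 (leq_trans lt) //= /entry /=.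
exact: first_asc_desc h.
Qed.

(** * From permutations to words *)

Lemma containsP n (p : 'S_n) s :
  reflect (exists2 t, subseq t (one_line p) & same_order t s) (contains p s).
Proof.
apply: (iffP existsP) => [[m h]|[t /subseqP[m sz ->] h]].
  by exists (mask m (one_line p)); first exact: mask_subseq.
have szm : size m == n by rewrite sz size_map size_enum_ord.
by exists (Tuple szm).
Qed.

Definition pat_word (b : bool) : seq nat := if b then [:: 1; 3; 2] else [:: 2; 3; 1].

Lemma same_order_pat b t :
  same_order t (pat_word b) <-> exists x y z, t = [:: x; y; z] /\ pat b x y z.
Proof.
split.
  case/andP=> /eqP.
  case: t => [|x [|y [|z [|]]]]; try by case: (b).
  move=> _ /forallP h; exists x, y, z; split=> //.
  have g (i j : 'I_3) := eqP (forallP (h i) j).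
  (* These comparisons serve both patterns: 132 is read off from [x < z] and [z < y], and 231 from
     [z < x] and [x < y]. *)
  have := g ord0 (@Ordinal 3 1 isT); have := g ord0 (@Ordinal 3 2 isT).
  have := g (@Ordinal 3 1 isT) (@Ordinal 3 2 isT).
  have := g (@Ordinal 3 2 isT) (@Ordinal 3 1 isT).
  have := g (@Ordinal 3 2 isT) ord0.
  by rewrite /pat; case: (b) => /=; lia.
case=> x [y [z [-> h]]]; rewrite /same_order.
apply/andP; split; first by case: (b).
apply/forallP=> -[[|[|[|i]]] hi] //; apply/forallP=> -[[|[|[|j]]] hj] //;
 move: h; rewrite /pat; case: (b) => /=; lia.
Qed.

Lemma avoidsE n (p : 'S_n) b :
  avoids p (pat_word b) <-> word_avoids b (one_line p).
Proof.
split=> [/negP h x y z s|h]; first apply/negP=> pt.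
  apply: h; apply/containsP; exists [:: x; y; z] => //.
  by apply/same_order_pat; exists x, y, z.
apply/negP=> /containsP[t st /same_order_pat[x [y [z [e pt]]]]].
by rewrite e in st; move: (h _ _ _ st); rewrite pt.
Qed.

Lemma one_line_perm n (p : 'S_n) : perm_eq (one_line p) (iota 1 n).
Proof.
have -> : iota 1 n = [seq i.+1 | i <- iota 0 n] by rewrite -[1]addn0 iotaDl.
rewrite -val_enum_ord -map_comp /one_line.
rewrite (map_comp (fun i : 'I_n => (val i).+1) p); apply: perm_map.
apply: uniq_perm; rewrite ?(map_inj_uniq (@perm_inj _ p)) ?enum_uniq // => i.
by rewrite mem_enum -[i](permKV p) map_f ?mem_enum.
Qed.

Lemma one_line_inj n : injective (@one_line n).
Proof.
move=> p q /eq_in_map e; apply/permP => i.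
by have := e i (mem_enum _ _); case=> /val_inj.
Qed.

Lemma one_line_surj n w : perm_eq w (iota 1 n) -> exists p : 'S_n, one_line p = w.
Proof.
move=> pw; have sz : size w = n by rewrite (perm_size pw) size_iota.
have uw : uniq w by rewrite (perm_uniq pw) iota_uniq.
have hw i : i < n -> 0 < nth 0 w i <= n.
  by move=> lt; have := mem_nth 0 (_ : i < size w); rewrite sz (perm_mem pw) mem_iota => /(_ lt).
(* Letters run from 1 to [n] while ['S_n] acts on 0 to [n - 1], hence the predecessor. *)
have lt (i : 'I_n) : (nth 0 w i).-1 < n by move: (hw i (ltn_ord i)); lia.
have fI : injective (fun i : 'I_n => Ordinal (lt i)).
  move=> i j /(congr1 val) /= e; apply/val_inj/eqP.
  rewrite -(nth_uniq 0 _ _ uw) ?sz ?ltn_ord //; apply/eqP.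
  have /andP[i0 _] := hw i (ltn_ord i); have /andP[j0 _] := hw j (ltn_ord j).
  by rewrite -(prednK i0) e prednK.
exists (perm fI); apply: (@eq_from_nth _ 0); rewrite size_map size_enum_ord ?sz // => i lti.
rewrite (nth_map (Ordinal lti)) ?size_enum_ord // permE /= nth_enum_ord //.
by rewrite prednK //; case/andP: (hw i lti).
Qed.

(** [one_line] is a bijection onto the rearrangements of [iota 1 n], so both sides measure
    duplicate-free lists with the same members. *)
Lemma num_desarrE n b :
  num_desarr n [:: pat_word b] =
  count (fun w => ~~ odd (first_asc w)) (avoiders b n n 1).
Proof.
rewrite /num_desarr cardE -(size_map (@one_line n)) -size_filter.
apply/perm_size/uniq_perm.
- by rewrite (map_inj_uniq (@one_line_inj n)) enum_uniq.
- by rewrite filter_uniq // avoiders_uniq.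
move=> w; rewrite mem_filter; apply/mapP/andP.
  case=> p; rewrite mem_enum inE /= andbT /desarrangement first_ascentE.
  case/andP=> h /avoidsE av ->; split=> //.
  by apply/avoidersP => //; split; first exact: one_line_perm.
case=> h /(avoidersP _ _ _ (leqnn n))[pw av].
have [p pe] := one_line_surj pw; exists p => //.
by rewrite mem_enum inE /= andbT /desarrangement first_ascentE pe h; apply/avoidsE; rewrite pe.
Qed.

(** * Counting the avoiders by the parity of their first ascent *)

Lemma count_allpairs_dep (S T : eqType) (U : Type) (P : pred U) (h : S -> T -> U)
    (s : seq S) (t : S -> seq T) :
  count P [seq h x y | x <- s, y <- t x] =
  \sum_(x <- s) count (fun y => P (h x y)) (t x).
Proof.
rewrite count_flatten -map_comp sumnE big_map; apply: eq_bigr => x _ /=.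
by rewrite count_map.
Qed.

Lemma count_pairs (S T : eqType) (P : pred S) (Q : pred T) (s : seq S) (t : seq T) :
  count (fun p => P p.1 && Q p.2) [seq (x, y) | x <- s, y <- t] =
  count P s * count Q t.
Proof.
rewrite count_allpairs_dep; elim: s => [|x s IH]; first by rewrite big_nil.
rewrite big_cons IH /= mulnDl; congr (_ + _).
by case: (P x); rewrite ?mul1n // mul0n count_pred0.
Qed.

Section Counting.
Local Open Scope ring_scope.

Lemma size_avoiders b f n a : (n <= f)%N -> (size (avoiders b f n a))%:R = catalan n.
Proof.
elim: f n a => [|f IH] [|n] a; rewrite ?ltnS ?catalan0 // => nf.
rewrite avoidersS -count_predT count_allpairs_dep.
rewrite -[n.+1]subn0 -/(index_iota 0 n.+1) big_mkord natr_sum subn0 catalanS.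
apply: eq_bigr => k _; rewrite (count_pairs predT predT) natrM !count_predT.
by rewrite !IH //; move: (ltn_ord k); lia.
Qed.

(** Grouping by the length [k] of the part before the maximum reproduces [Fine_rec] term by term. *)
Lemma count_avoiders_even b f n a : (n <= f)%N ->
  (count (fun w => ~~ odd (first_asc w)) (avoiders b f n a))%:R = Fine n.+1.
Proof.
elim: f n a => [|f IH] [|n] a; rewrite ?ltnS ?Fine1 // => nf.
rewrite avoidersS count_allpairs_dep.
rewrite -[n.+1]subn0 -/(index_iota 0 n.+1) big_mkord natr_sum subn0 Fine_rec.
(* The group [k = 0] is matched with [Fine 1 * catalan n - Fine n.+1]: prefixing the maximum to [R]
   flips the parity, so the admissible [R] are the avoiders with odd first ascent. *)
rewrite big_ord_recl [in RHS]big_ord_recl Fine1 mul1r addrAC; congr (_ + _).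
  have -> : avoiders b f (ord0 : 'I_n.+1) (a + lshift_words b n (ord0 : 'I_n.+1)) = [:: [::]].
    by case: (f).
  rewrite count_allpairs_dep big_seq1 subn0 -(size_avoiders b (a + rshift_words b 0) nf).
  rewrite -(IH n (a + rshift_words b 0)) //.
  rewrite -(count_predC (fun w => ~~ odd (first_asc w))) natrD addrC addKr.
  congr (_%:R); apply: eq_in_count => w /(avoidersP _ _ _ nf)[pw _].
  rewrite -[LHS]/(~~ odd (first_asc ((a + n)%N :: w))).
  rewrite first_asc_cons_max //= => x; rewrite (perm_mem pw) mem_iota.
  by rewrite /rshift_words /= if_same addn0 => /andP[].
(* For nonempty [L] the parity is that of [L] and [R] is free, so each group contributes a
   product. *)
apply: eq_bigr => k _; have kn := ltn_ord k.
rewrite !lift0 -(IH k.+1 (a + lshift_words b n k.+1)); last lia.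
rewrite -(@size_avoiders b f (n - k.+1) (a + rshift_words b k.+1)); last lia.
rewrite -natrM -(count_predT (avoiders _ _ (_ - _) _)) -count_pairs; congr (_%:R).
apply: eq_in_count => _ /allpairsP[[L R] [/= hL _ ->]] /=; rewrite andbT.
have kf : (k.+1 <= f)%N by lia.
have [pL _] := (avoidersP _ _ _ kf).1 hL.
rewrite first_asc_cat_max //; first by rewrite -size_eq0 (perm_size pL) size_iota.
move=> x; rewrite (perm_mem pL) mem_iota.
by rewrite /lshift_words; case: (b); lia.
Qed.

End Counting.

Theorem theorem3p8 (n : nat) (sigma : seq nat) (hn : (2 <= n)%N)
    (hsigma : sigma \in [:: [:: 1; 3; 2]; [:: 2; 3; 1]]%N) :
  (num_desarr n [:: sigma])%:R%R = Fine n.+1.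
Proof.
have [b ->] : exists b, sigma = pat_word b.
  by move: hsigma; rewrite !inE => /orP[] /eqP->; [exists true | exists false].
by rewrite num_desarrE count_avoiders_even.
Qed.
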